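(* Let $m,\ell\in\mathbb{N}_0$ and $p,n\in\mathbb{N}$ with $(m,\ell)\neq(0,0)$ and $p\ge2$. The Padé iteration $$Y_{k+1}=Y_k\,Q_{\ell,m,p}(Z_kY_k)^{p-1},\qquad Z_{k+1}=Q_{\ell,m,p}(Z_kY_k)\,Z_k$$ is stable in a neighborhood of $(B,B^{-1})$ for any invertible $B\in\mathbb{C}^{n\times n}$. In particular, with $g(Y,Z)=\left(Y\,Q_{\ell,m,p}(ZY)^{p-1},\;Q_{\ell,m,p}(ZY)\,Z\right)$, we have $$L_g(B,B^{-1};E,F)=\frac1p\left(E-(p-1)BFB,\;(p-1)F-B^{-1}EB^{-1}\right)$$ for any $E,F\in\mathbb{C}^{n\times n}$, and $L_g(B,B^{-1};\cdot,\cdot)$ is idempotent.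
   Context: $P_{m,\ell,p}(z)$ denotes the type-$(m,\ell)$ Padé approximant of $z^{1/p}$ at $z=1$ (a ratio of a polynomial of degree $\le m$ to a polynomial of degree $\le\ell$), and $Q_{\ell,m,p}(z)=P_{m,\ell,p}(z)^{-1}$; rational functions are evaluated at matrices in the usual sense. $L_g(Y,Z;E,F)$ denotes the Fréchet derivative of $g$ at $(Y,Z)$ in the direction $(E,F)$. A matrix iteration $X_{k+1}=g(X_k)$ with fixed point $X_*$ is stable in a neighborhood of $X_*$ if the Fréchet derivative of $g$ at $X_*$ has bounded powers: there is a constant $c>0$ such that $\|G^j(E)\|\le c\|E\|$ for every $j$ and every direction $E$, where $G(E)=L_g(X_*,E)$. Here the iteration acts on pairs $(Y,Z)$ of $n\times n$ complex matrices. *)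

(* Defs.v *)
From HB Require Import structures.
From mathcomp Require Export all_boot all_order all_algebra complex.
From mathcomp Require Export all_classical all_reals all_analysis.

Set Implicit Arguments.
Unset Strict Implicit.
Unset Printing Implicit Defensive.

Export Order.TTheory GRing.Theory Num.Theory numFieldNormedType.Exports.

#[global] Open Scope classical_set_scope.
#[global] Open Scope ring_scope.

(* The complex numbers R[i], packaged as a numClosedFieldType so that the
   topological and normed structures that MathComp-Analysis puts on an abstract
   numFieldType, and on matrices over it, are inferred; there are no such
   instances for R[i] itself. *)
Definition Cplx (R : realType) : numClosedFieldType := R[i]%C.

(* Principal argument, in ]-pi, pi] for z != 0. *)
Definition carg (R : realType) (z : Cplx R) : R :=
  let t := acos (complex.Re z / Normc.normc z) in
  if 0 <= complex.Im z then t else - t.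

(* Principal branch of z |-> z^{1/p}. *)
Definition proot (R : realType) (p : nat) (z : Cplx R) : Cplx R :=
  ((Normc.normc z `^ p%:R^-1)%:C *
   (cos (carg z / p%:R) +i* sin (carg z / p%:R)))%C.

(* N / D is the type-(m, l) Pade approximant of f at a;
   recall that size N <= m.+1 means deg N <= m. *)
Definition is_pade (K : numFieldType) (f : K -> K) (a : K) (m l : nat)
    (N D : {poly K}) : Prop :=
  [/\ (size N <= m.+1)%N, (size D <= l.+1)%N, D.[a] != 0 &
      exists c : K, \forall z \near a,
        `|f z - N.[z] / D.[z]| <= c * `|z - a| ^+ (m + l + 1)].

(* N / D evaluated at a matrix A; meaningful when D(A) is invertible. *)
Definition ratmx (K : fieldType) (n : nat) (N D : {poly K})
    (A : 'M[K]_n.+1) : 'M[K]_n.+1 :=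
  horner_mx A N *m invmx (horner_mx A D).

(* The iteration function for P = N / D, hence Q = P^-1 = D / N. *)
Definition pade_step (K : fieldType) (n p : nat) (N D : {poly K})
    (X : 'M[K]_n.+1 * 'M[K]_n.+1) : 'M[K]_n.+1 * 'M[K]_n.+1 :=
  let Q := ratmx D N in
  let: (Y, Z) := X in (Y *m Q (Z *m Y) ^+ p.-1, Q (Z *m Y) *m Z).

(* Stability of the iteration x_{k+1} = g x_k at its fixed point x.
   Differentiability is explicit because 'd g x is a default value
   when g is not differentiable at x. *)
Definition stable_at (K : numFieldType) (V : normedModType K)
    (g : V -> V) (x : V) : Prop :=
  [/\ g x = x, differentiable g x &
      exists2 c : K, 0 < c &
        forall (j : nat) (e : V), `|iter j ('d g x) e| <= c * `|e|].

(* Main.v *)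
From HB Require Import structures.
From mathcomp Require Import ring.
Require Import Defs.

(** Write Q = D / N for the reciprocal of the Pade approximant N / D. Only two
    facts about the approximant matter: N and D take the same nonzero value at 1,
    and (N / D)'(1) = 1 / p, hence Q(1) = 1 and Q'(1) = - 1 / p.

    These are obtained in [pade_slope] without differentiating the p-th root.
    Along z = t ^ p with t > 1 the root is t, so the order condition, whose
    exponent m + l + 1 is at least 2, says that the polynomial
    h(t) = t D(t ^ p) - N(t ^ p) is O((t - 1) ^ 2) as t tends to 1 from the right.
    Thus h(1) = h'(1) = 0, and h'(1) = D(1) + p (D'(1) - N'(1)).

    Matrix multiplication is continuous and bilinear and inversion is
    differentiable, so the iteration function g is differentiable by the usual
    rules. At the fixed point Z Y = B^-1 B = 1 is scalar and so commutes with
    every direction. There a rational function r has the differential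
    H |-> r'(1) H ([is_diff_ratmx]), and the product rule gives the stated formula
    ([is_diff_pade_step]). The formula is idempotent by direct computation, and an
    idempotent continuous linear map G has only the powers 1 and G, which are
    bounded. *)

Set Implicit Arguments.
Unset Strict Implicit.
Unset Printing Implicit Defensive.

(** * Continuity and differentiability of matrix operations *)

Lemma cvg_mx (K : numFieldType) (T : Type) (F : set_system T) {FF : Filter F}
    (m n : nat) (f : T -> 'M[K]_(m, n)) (A : 'M[K]_(m, n)) :
  (forall i j, f x i j @[x --> F] --> A i j) -> f @ F --> A.
Proof.
move=> fA; apply/cvg_ballP => e e0.
have : \forall x \near F, forall i j, ball (A i j) e (f x i j).
  apply: filter_forall => i; apply: filter_forall => j.
  by move/cvg_ballP: (fA i j); apply.
by apply: filterS => x Hx; split.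
Qed.

Lemma cvg_coord (K : numFieldType) (T : Type) (F : set_system T) {FF : Filter F}
    (m n : nat) (f : T -> 'M[K]_(m, n)) (A : 'M[K]_(m, n)) i j :
  f @ F --> A -> f x i j @[x --> F] --> A i j.
Proof.
move=> fA.
exact: (cvg_comp f (fun M : 'M[K]_(m, n) => M i j) fA
  (@coord_continuous K m n i j A)).
Qed.

Lemma cvg_mulmx (K : numFieldType) (T : Type) (F : set_system T) {FF : Filter F}
    (m n q : nat) (f : T -> 'M[K]_(m, n)) (g : T -> 'M[K]_(n, q))
    (A : 'M[K]_(m, n)) (B : 'M[K]_(n, q)) :
  f @ F --> A -> g @ F --> B -> f x *m g x @[x --> F] --> A *m B.
Proof.
move=> fA gB; apply: cvg_mx => i k; rewrite mxE.
under eq_fun do rewrite mxE.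
apply: cvg_big => [|j _]; first exact: add_continuous.
by apply: cvgM; apply: cvg_coord.
Qed.

Lemma cvg_det (K : numFieldType) (T : Type) (F : set_system T) {FF : Filter F}
    (n : nat) (f : T -> 'M[K]_n) (A : 'M[K]_n) :
  f @ F --> A -> \det (f x) @[x --> F] --> \det A.
Proof.
move=> fA; apply: cvg_big => [|s _]; first exact: add_continuous.
apply: cvgMr; apply: cvg_big => [|i _]; first exact: mul_continuous.
exact: cvg_coord.
Qed.

Lemma cvg_adj (K : numFieldType) (T : Type) (F : set_system T) {FF : Filter F}
    (n : nat) (f : T -> 'M[K]_n) (A : 'M[K]_n) :
  f @ F --> A -> \adj (f x) @[x --> F] --> \adj A.
Proof.
move=> fA; apply: cvg_mx => i j; rewrite mxE.
under eq_fun do rewrite mxE.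
apply: cvgMr; apply: cvg_det; apply: cvg_mx => a b; rewrite !mxE.
under eq_fun do rewrite !mxE.
exact: cvg_coord.
Qed.

Lemma near_unitmx (K : numFieldType) (T : Type) (F : set_system T)
    {FF : Filter F} (n : nat) (f : T -> 'M[K]_n) (A : 'M[K]_n) :
  A \in unitmx -> f @ F --> A -> \forall x \near F, f x \in unitmx.
Proof.
move=> uA fA.
have cdet : \det (f x) @[x --> F] --> \det A by exact: cvg_det.
have dA : \det A != 0 by rewrite -unitfE -unitmxE.
have : \forall x \near F, \det (f x) != 0 by exact: (cvgr_neq0 (\det A)).
by apply: filterS => x; rewrite unitmxE unitfE.
Qed.

Lemma cvg_invmx (K : numFieldType) (T : Type) (F : set_system T) {FF : Filter F}
    (n : nat) (f : T -> 'M[K]_n) (A : 'M[K]_n) :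
  A \in unitmx -> f @ F --> A -> invmx (f x) @[x --> F] --> invmx A.
Proof.
move=> uA fA.
have cdet : \det (f x) @[x --> F] --> \det A by exact: cvg_det.
have dA : \det A != 0 by rewrite -unitfE -unitmxE.
have : (\det (f x))^-1 *: \adj (f x) @[x --> F] --> (\det A)^-1 *: \adj A.
  exact: (cvgZ (cvgV dA cdet) (cvg_adj fA)).
rewrite {2}/invmx uA; apply: cvg_trans.
apply: near_eq_cvg.
have : \forall x \near F, f x \in unitmx by exact: near_unitmx uA fA.
by apply: filterS => x ux; rewrite /invmx ux.
Qed.

Lemma mulmx_continuous (K : numFieldType) (m n q : nat) :
  continuous (fun p : 'M[K]_(m, n) * 'M[K]_(n, q) => p.1 *m p.2).
Proof. by move=> p; apply: cvg_mulmx; [apply: cvg_fst|apply: cvg_snd]. Qed.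

Lemma is_diff_mulmx (K : numFieldType) (V : normedModType K) (m n q : nat)
    (f df : V -> 'M[K]_(m, n)) (g dg : V -> 'M[K]_(n, q)) x :
  is_diff x f df -> is_diff x g dg ->
  is_diff x (fun y => f y *m g y) (fun h => f x *m dg h + df h *m g x).
Proof.
move=> fx gx.
have mulx : is_diff (f x, g x) (fun p : 'M[K]_(m, n) * 'M[K]_(n, q) => p.1 *m p.2)
    (fun p => f x *m p.2 + p.1 *m g x).
  apply: DiffDef; last by rewrite diff_bilin//; exact: mulmx_continuous.
  by apply: differentiable_bilin; exact: mulmx_continuous.
exact: (is_diff_comp (is_diff_pair fx gx) mulx).
Qed.

(** The norm of a matrix is its largest entry in absolute value, so it is
    submultiplicative only up to a constant. *)
Lemma mulmx_norm_le (K : numFieldType) (m n q : nat) :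
  exists2 k : K, 0 < k & forall (A : 'M[K]_(m, n)) (B : 'M[K]_(n, q)),
  `|A *m B| <= k * `|A| * `|B|.
Proof. by apply: bilinear_schwarz; exact: mulmx_continuous. Qed.

Lemma is_diff_le (K : numFieldType) (V W : normedModType K) (f : V -> W)
    (df : {linear V -> W}) (x : V) :
  continuous df ->
  (forall e, 0 < e -> \forall y \near x,
     `|f y - (f x + df (y - x))| <= e * `|y - x|) ->
  is_diff x f df.
Proof.
move=> dfc fdf.
have fo : f \o shift x = cst (f x) + df +o_ (0 : V) id.
  apply/eqaddoP => e e0; have /nbhs0P := fdf _ e0.
  by apply: filterS => h; rewrite [x + h]addrC addrK.
apply: DiffDef; last exact: diff_unique dfc fo.
by apply/diff_locallyP; rewrite (diff_unique dfc fo).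
Qed.

(** With V the inverse of A, the remainder of invmx at first order is the product
    (V - invmx X) (X - A) V; the first factor tends to 0 by continuity. *)
Lemma is_diff_invmx (K : numFieldType) (n : nat) (A : 'M[K]_n) :
  A \in unitmx ->
  is_diff A (@invmx K n) (fun H : 'M[K]_n => - (invmx A *m H *m invmx A)).
Proof.
move=> uA; pose V : 'M[K]_n := invmx A.
pose d (H : 'M[K]_n) : 'M[K]_n := - (V *m H *m V).
have lind : linear d.
  by move=> a H1 H2; rewrite /d mulmxDr mulmxDl -scalemxAr -scalemxAl opprD scalerN.
pose dlM := GRing.isLinear.Build _ _ _ _ _ lind.
pose dL : {linear 'M[K]_n -> 'M[K]_n} := HB.pack d dlM.
have dc : continuous dL.
  move=> H; apply: differentiable_continuous.
  have := is_diff_mulmx (is_diff_mulmx (is_diff_cst V H) (is_diff_id H))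
    (is_diff_cst V H).
  by move=> /is_diffN[].
apply: (@is_diff_le K _ _ _ dL) => // e e0.
have [k k0 kmul] := mulmx_norm_le K n n n.
have cV : invmx X @[X --> A] --> V.
  exact: (@cvg_invmx K _ (nbhs A) _ n id A uA cvg_id).
have uX : \forall X \near A, X \in unitmx.
  exact: (@near_unitmx K _ (nbhs A) _ n id A uA cvg_id).
near=> X.
have XA : X \in unitmx by near: X.
have -> : invmx X - (invmx A + dL (X - A)) = (V - invmx X) *m (X - A) *m V.
  rewrite /= /d -/V opprD opprK !mulmxBl [RHS]addrC addrA; congr (_ + _).
  rewrite mulmxBr mulVmx// mulmxBl -mulmxA mulmxV// mulmx1 mul1mx.
  by rewrite opprB.
apply: (le_trans (kmul _ _)).
apply: (@le_trans _ _ (k * (k * `|V - invmx X| * `|X - A|) * `|V|)).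
  by rewrite ler_wpM2r// ler_wpM2l// ltW.
have -> : k * (k * `|V - invmx X| * `|X - A|) * `|V| =
   (k * k * `|V| * `|V - invmx X|) * `|X - A| by ring.
rewrite ler_wpM2r//.
have : `|V - invmx X| <= e / (k * k * `|V| + 1).
  near: X; apply: cvgr_dist_le => //; rewrite divr_gt0// ltr_wpDl//.
  by rewrite !mulr_ge0// ltW.
rewrite ler_pdivlMr; last by rewrite ltr_wpDl// !mulr_ge0// ltW.
by apply: le_trans; rewrite mulrC ler_wpM2l// lerDl.
Unshelve. all: by end_near. Qed.

(** * Rational functions near a scalar matrix *)

Lemma horner_mx_scalar (R : comNzRingType) (n : nat) (P : {poly R}) (a : R) :
  horner_mx (a%:M : 'M[R]_n.+1) P = P.[a]%:M.
Proof.
elim/poly_ind: P => [|P c IH]; first by rewrite rmorph0 horner0 raddf0.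
rewrite rmorphD rmorphM /= horner_mx_X horner_mx_C IH !hornerE raddfD /=.
by rewrite scalar_mxM.
Qed.

(** A scalar matrix commutes with every direction, so there a polynomial has the
    differential of the scalar case. *)
Lemma is_diff_horner_mx (K : numFieldType) (V : normedModType K) (n : nat)
    (P : {poly K}) (f df : V -> 'M[K]_n.+1) (x : V) (a : K) :
  is_diff x f df -> f x = a%:M ->
  is_diff x (fun y => horner_mx (f y) P) (fun h => P^`().[a] *: df h).
Proof.
move=> fx fxa.
elim/poly_ind: P => [|P c IH].
  have := is_diff_cst (0 : 'M[K]_n.+1) x.
  rewrite (_ : cst 0 = fun y => horner_mx (f y) 0); last first.
    by apply/funext => y; rewrite rmorph0.
  by move/is_diff_eq; apply; apply/funext => h; rewrite deriv0 horner0 scale0r.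
have := is_diffD (is_diff_mulmx IH fx) (is_diff_cst (c%:M : 'M[K]_n.+1) x).
rewrite (_ : _ + cst _ = (fun y => horner_mx (f y) (P * 'X + c%:P))); last first.
  by apply/funext => y; rewrite !fctE rmorphD rmorphM /= horner_mx_X horner_mx_C.
move/is_diff_eq; apply; apply/funext => h; rewrite !fctE fxa horner_mx_scalar.
rewrite derivD derivM derivX derivC !hornerE mul_scalar_mx mul_mx_scalar.
by rewrite scalerA -scalerDl addrC mulrC.
Qed.

Lemma is_diff_ratmx (K : numFieldType) (V : normedModType K) (n : nat)
    (N D : {poly K}) (f df : V -> 'M[K]_n.+1) (x : V) (a : K) :
  is_diff x f df -> f x = a%:M -> D.[a] != 0 ->
  is_diff x (fun y => ratmx N D (f y))
    (fun h => ((N^`().[a] * D.[a] - N.[a] * D^`().[a]) / D.[a] ^+ 2) *: df h).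
Proof.
move=> fx fxa Da.
have uD : horner_mx (f x) D \in unitmx.
  by rewrite fxa horner_mx_scalar unitmxE det_scalar unitrX// unitfE.
have := is_diff_mulmx (is_diff_horner_mx N fx fxa)
  (is_diff_comp (is_diff_horner_mx D fx fxa) (is_diff_invmx uD)).
move/is_diff_eq; apply; apply/funext => h /=.
rewrite fxa !horner_mx_scalar invmx_scalar !mul_scalar_mx !mul_mx_scalar.
rewrite !scalerN !scalerA -scaleNr -scalerDl; congr (_ *: _).
by field.
Qed.

Lemma is_diff_expr1 (K : numFieldType) (V : normedModType K) (n : nat)
    (f df : V -> 'M[K]_n.+1) (x : V) (k : nat) :
  is_diff x f df -> f x = 1%:M ->
  is_diff x (fun y => f y ^+ k) (fun h => k%:R *: df h).
Proof.
move=> fx fx1.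
have := is_diff_horner_mx 'X^k fx fx1.
rewrite (_ : (fun y => _) = fun y => f y ^+ k); last first.
  by apply/funext => y; rewrite rmorphXn /= horner_mx_X.
move/is_diff_eq; apply; apply/funext => h /=.
by rewrite derivXn hornerMn hornerXn expr1n.
Qed.

Lemma is_diff_fst (K : numFieldType) (V W : normedModType K) (x : V * W) :
  is_diff x fst fst.
Proof.
have c : continuous (fst : {linear (V * W)%type -> V}) by move=> y; apply: cvg_fst.
by apply: DiffDef; [exact: linear_differentiable|exact: diff_lin].
Qed.

Lemma is_diff_snd (K : numFieldType) (V W : normedModType K) (x : V * W) :
  is_diff x snd snd.
Proof.
have c : continuous (snd : {linear (V * W)%type -> W}) by move=> y; apply: cvg_snd.
by apply: DiffDef; [exact: linear_differentiable|exact: diff_lin].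
Qed.

(** * The differential of the iteration *)

(** The differential of the Pade iteration at (B, invmx B), evaluated at the
    direction X = (E, F). *)
Definition pade_step_diff (K : numFieldType) (n p : nat) (B : 'M[K]_n.+1)
    (X : 'M[K]_n.+1 * 'M[K]_n.+1) : 'M[K]_n.+1 * 'M[K]_n.+1 :=
  p%:R^-1 *: (X.1 - (p.-1)%:R *: (B *m X.2 *m B),
              (p.-1)%:R *: X.2 - invmx B *m X.1 *m invmx B).

(** The hypotheses on N and D say that D / N has the value 1 and the derivative
    - 1 / p at 1. *)
Lemma is_diff_pade_step (K : numFieldType) (n p : nat) (N D : {poly K})
    (B : 'M[K]_n.+1) :
  (0 < p)%N -> B \in unitmx -> N.[1] != 0 -> D.[1] = N.[1] ->
  p%:R * (N^`().[1] - D^`().[1]) = N.[1] ->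
  pade_step p N D (B, invmx B) = (B, invmx B) /\
  is_diff (B, invmx B) (@pade_step K n p N D) (pade_step_diff p B).
Proof.
move=> p0 uB N1 DN dDN.
pose x : 'M[K]_n.+1 * 'M[K]_n.+1 := (B, invmx B).
have Q1 : ratmx D N (1%:M : 'M[K]_n.+1) = 1%:M.
  by rewrite /ratmx !horner_mx_scalar DN invmx_scalar -scalar_mxM divff.
have pK : p%:R != 0 :> K by rewrite pnatr_eq0 -lt0n.
(* The derivative of D / N at 1. *)
have slope : (D^`().[1] * N.[1] - D.[1] * N^`().[1]) / N.[1] ^+ 2 = - p%:R^-1.
  have -> : D^`().[1] = N^`().[1] - N.[1] / p%:R.
    by rewrite -dDN; field.
  by rewrite DN; field; rewrite N1 pK.
split.
  by rewrite /pade_step mulVmx// Q1 expr1n mulmx1 mul1mx.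
have dY := is_diff_fst x.
have dZ := is_diff_snd x.
have dZY := is_diff_mulmx dZ dY.
have ZY1 : x.2 *m x.1 = 1%:M by rewrite mulVmx.
have := is_diff_ratmx D dZY ZY1 N1; rewrite slope => dQ.
have Qx : ratmx D N (x.2 *m x.1) = 1%:M by rewrite ZY1.
have dg := is_diff_pair (is_diff_mulmx dY (is_diff_expr1 p.-1 dQ Qx))
  (is_diff_mulmx dQ dZ).
move: dg.
rewrite (_ : (fun y => (_ *m _, _ *m _)) = @pade_step K n p N D); last first.
  by apply/funext => -[].
move=> dg; apply: (is_diff_eq dg); apply/funext => -[E F].
rewrite /pade_step_diff /= Qx expr1n mulmx1 mul1mx.
have pV : p%:R^-1 * (p.-1)%:R = 1 - p%:R^-1 :> K.
  by rewrite -subn1 natrB// mulrBr mulVf// mulr1.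
congr pair; rewrite scalerBr scalerA ?pV.
  rewrite -!scalemxAr scalerA mulmxDr !mulmxA mulmxV// mul1mx.
  rewrite mulrN [_ * p%:R^-1]mulrC pV scalerDr addrAC scaleNr scalerBl scale1r.
  by rewrite opprB subrK scaleNr.
rewrite -scalemxAl mulmxDl -[F *m B *m _]mulmxA mulmxV// mulmx1 scaleNr scalerDr.
by rewrite opprD addrCA addrC scalerBl scale1r.
Qed.

Lemma pade_step_diff_idem (K : numFieldType) (n p : nat) (B : 'M[K]_n.+1) X :
  (0 < p)%N -> B \in unitmx ->
  pade_step_diff p B (pade_step_diff p B X) = pade_step_diff p B X.
Proof.
move=> p0 uB; case: X => E F; rewrite /pade_step_diff /=.
have pK : p%:R != 0 :> K by rewrite pnatr_eq0 -lt0n.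
have qE : (p.-1)%:R = p%:R - 1 :> K by rewrite -subn1 natrB.
set q := (p.-1)%:R; set C := E - _; set G := _ *: F - _.
have BGB : B *m G *m B = q *: (B *m F *m B) - E.
  rewrite /G mulmxBr mulmxBl -scalemxAr -scalemxAl; congr (_ - _).
  by rewrite !mulmxA mulmxV// mul1mx -mulmxA mulVmx// mulmx1.
have BCB : invmx B *m C *m invmx B = invmx B *m E *m invmx B - q *: F.
  rewrite /C mulmxBr mulmxBl -scalemxAr -scalemxAl; congr (_ - _ *: _).
  by rewrite !mulmxA mulVmx// mul1mx -mulmxA mulmxV// mulmx1.
have CE : B *m G *m B = - C by rewrite BGB opprB.
have GE : invmx B *m C *m invmx B = - G by rewrite BCB opprB.
congr (_ *: _); congr pair; rewrite -?scalemxAr -?scalemxAl.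
  rewrite CE !scalerN opprK scalerA -scalerDl.
  by rewrite (_ : _ + _ = 1) ?scale1r// /q qE; field.
rewrite GE scalerN opprK scalerA -scalerDl.
by rewrite (_ : _ + _ = 1) ?scale1r// /q qE; field.
Qed.

(** * Value and slope of the Pade approximant at 1 *)

Lemma horner_continuous (K : numFieldType) (P : {poly K}) :
  continuous (fun x : K => P.[x]).
Proof.
move=> x; elim/poly_ind: P => [|P c IH].
  rewrite (_ : (fun x => _) = fun _ => 0); [exact: cst_continuous|].
  by apply/funext => y; rewrite horner0.
rewrite (_ : (fun x => _) = fun y => P.[y] * y + c); last first.
  by apply/funext => y; rewrite hornerMXaddC.
apply: (@continuousD _ _ _ (fun y => P.[y] * y)); last exact: cst_continuous.
by apply: (@continuousM _ _ (fun y => P.[y])).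
Qed.

Lemma proot_exprn (R : realType) (p : nat) (t : Cplx R) :
  (0 < p)%N -> 0 < t -> proot p (t ^+ p) = t.
Proof.
move=> p0; rewrite ltcE /= => /andP[/eqP]; case: t => x y /= -> x0.
have -> : ((x +i* 0)%C : Cplx R) ^+ p = ((x ^+ p) +i* 0)%C.
  exact: (esym (rmorphXn (@real_complex R) p x)).
have xp0 : 0 < x ^+ p by rewrite exprn_gt0.
have normx : Normc.normc ((x ^+ p) +i* 0)%C = x ^+ p.
  by rewrite /= expr0n addr0 sqrtr_sqr gtr0_norm.
rewrite /proot /carg normx /= lexx divff ?gt_eqF// acos1 mul0r cos0 sin0.
rewrite -powR_mulrn; last exact: ltW.
rewrite -powRrM mulfV ?pnatr_eq0 -?lt0n// powRr1; last exact: ltW.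
by rewrite mulr1.
Qed.

(** If f inverts t |-> t ^ p on the positive numbers and m + l > 0, then N / D has
    the value 1 and the derivative 1 / p at 1. *)
Lemma pade_slope (K : numFieldType) (f : K -> K) (m l p : nat)
    (N D : {poly K}) :
  (0 < m + l)%N -> (0 < p)%N -> (forall t, 0 < t -> f (t ^+ p) = t) ->
  is_pade f 1 m l N D ->
  [/\ N.[1] != 0, D.[1] = N.[1] & p%:R * (N^`().[1] - D^`().[1]) = N.[1]].
Proof.
move=> ml p0 fp [_ _ D1 [c fc]].
have f1 : f 1 = 1 by rewrite -[X in f X](expr1n _ p) fp.
have ND : N.[1] = D.[1].
  have := nbhs_singleton fc; rewrite f1 subrr normr0 addn1 expr0n mulr0.
  rewrite normr_le0 subr_eq0 => /eqP /esym/(canRL (divfK D1)).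
  by rewrite mul1r.
(* Both h and 'X^p - 1 vanish at 1. The goal is that the cofactor k of h vanishes
   there as well, so that 1 is a double root of h. *)
pose h := 'X * (D \Po 'X^p) - (N \Po 'X^p).
have [k hk] : exists k, h = k * ('X - 1%:P).
  apply/factor_theorem; rewrite /root /h !hornerE !horner_comp !hornerE expr1n.
  by rewrite ND subrr.
have [s ps] : exists s, 'X^p - 1 = s * ('X - 1%:P) :> {poly K}.
  by apply/factor_theorem; rewrite /root !hornerE expr1n subrr.
pose S := (D \Po 'X^p) * s ^+ (m + l).+1 * ('X - 1%:P) ^+ (m + l).
have cX : t ^+ p @[t --> (1 : K)] --> (1 : K).
  have := @horner_continuous K 'X^p 1; rewrite /continuous_at hornerXn expr1n.
  by under eq_fun do rewrite hornerXn.
(* The order condition at t ^ p, multiplied by |D(t ^ p)| / |t - 1|. *)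
have kS : \forall t \near (1 : K)^'+, `|k.[t]| <= c * `|S.[t]|.
  have ft : \forall t \near (1 : K)^'+,
      `|f (t ^+ p) - N.[t ^+ p] / D.[t ^+ p]| <= c * `|t ^+ p - 1| ^+ (m + l + 1).
    exact: (cvg_at_right_filter cX) fc.
  have Dt : \forall t \near (1 : K)^'+, D.[t ^+ p] != 0.
    have /(cvg_at_right_filter cX) : \forall z \near (1 : K), D.[z] != 0.
      exact: (cvgr_neq0 D.[1] (@horner_continuous K D 1)).
    by [].
  near=> t.
  have t1 : 1 < t by near: t; exact: nbhs_right_gt.
  have Dt0 : D.[t ^+ p] != 0 by near: t.
  have : `|f (t ^+ p) - N.[t ^+ p] / D.[t ^+ p]| <= c * `|t ^+ p - 1| ^+ (m + l + 1).
    by near: t.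
  rewrite fp; last exact: lt_trans t1.
  have -> : t ^+ p - 1 = s.[t] * (t - 1).
    by have := congr1 (horner^~ t) ps; rewrite !hornerE.
  have -> : t - N.[t ^+ p] / D.[t ^+ p] = k.[t] * (t - 1) / D.[t ^+ p].
    have := congr1 (horner^~ t) hk.
    rewrite /h !hornerE !horner_comp !hornerE => <-.
    by rewrite mulrBl mulfK.
  rewrite !normrM normfV ler_pdivrMr ?normr_gt0// exprMn.
  have t10 : 0 < `|t - 1| by rewrite normr_gt0 subr_eq0 gt_eqF.
  move=> kt; rewrite -(ler_pM2r t10); apply: (le_trans kt).
  rewrite /S !hornerE horner_comp !hornerE !normrM !normrX addn1.
  rewrite le_eqVlt; apply/orP; left; apply/eqP => /=.
  by rewrite [`|t - 1| ^+ _.+1]exprSr; ring.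
have S0 : c * `|S.[t]| @[t --> (1 : K)^'+] --> (0 : K).
  (* The factor t - 1 survives in S because m + l is positive. *)
  have S1 : c * `|S.[1]| = 0.
    by rewrite /S !hornerE subrr expr0n gtn_eqF// mulr0 normr0 mulr0.
  rewrite -S1; apply: (@cvg_at_right_filter K K (fun t => c * `|S.[t]|)).
  have cS : S.[t] @[t --> (1 : K)] --> S.[1] by exact: horner_continuous.
  exact: (cvgMr (cvg_norm cS)).
have k1 : k.[1] = 0.
  have kt0 : k.[t] @[t --> (1 : K)^'+] --> (0 : K).
    apply/cvgr0Pnorm_lt => e e0; near=> t.
    have kt : `|k.[t]| <= c * `|S.[t]| by near: t.
    apply: (le_lt_trans kt); rewrite -[X in X < _]ger0_norm; last exact: le_trans kt.
    by near: t; apply: cvgr0_norm_lt.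
  apply: (cvg_unique _ _ kt0) => //.
  apply: (@cvg_at_right_filter K K (horner k)).
  exact: horner_continuous.
split; [by rewrite ND|by rewrite ND|].
have : h^`().[1] = 0 by rewrite hk derivM derivXsubC !hornerE k1 subrr mulr0 addr0.
rewrite /h derivB derivM derivX !deriv_comp derivXn !hornerE !horner_comp.
rewrite !hornerMn !hornerXn !expr1n => h1.
apply/eqP; rewrite -subr_eq0 ND -oppr_eq0; apply/eqP; rewrite -[RHS]h1; ring.
Unshelve. all: by end_near. Qed.

(** * Stability *)

(** The powers of an idempotent differential are the identity and itself. *)
Lemma stable_at_idempotent (K : numFieldType) (V : normedModType K)
    (g : V -> V) (x : V) :
  g x = x -> differentiable g x ->
  (forall e, 'd g x ('d g x e) = 'd g x e) -> stable_at g x.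
Proof.
move=> gx dg idem; split=> //.
have [c c0 dc] := linear_lipschitz (diff_continuous dg).
exists (1 + c); first by rewrite addr_gt0.
move=> j e; have [->/=|->] : iter j ('d g x) e = e \/ iter j ('d g x) e = 'd g x e.
- by case: j => [|j]; [left|right; elim: j => //= j ->].
- by rewrite ler_peMl// lerDl ltW.
- by rewrite (le_trans (dc e))// ler_wpM2r// lerDr.
Qed.

Theorem proposition3p7 (R : realType) (m l p n : nat) (N D : {poly Cplx R})
    (B : 'M[Cplx R]_n.+1) :
  (m, l) != (0%N, 0%N) -> (2 <= p)%N ->
  is_pade (@proot R p) 1 m l N D ->
  B \in unitmx ->
  let g := @pade_step (Cplx R) n p N D in
  let L := 'd g (B, invmx B) in
  [/\ stable_at g (B, invmx B),
      forall E F : 'M[Cplx R]_n.+1,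
        L (E, F) = p%:R^-1 *: (E - (p.-1)%:R *: (B *m F *m B),
                               (p.-1)%:R *: F - invmx B *m E *m invmx B) &
      forall X : 'M[Cplx R]_n.+1 * 'M[Cplx R]_n.+1, L (L X) = L X].
Proof.
move=> ml0 p2 pade uB g L.
have ml : (0 < m + l)%N by move: ml0; rewrite xpair_eqE addn_gt0 !lt0n negb_and.
have p0 : (0 < p)%N by exact: ltnW.
have [N1 DN dDN] := pade_slope ml p0 (fun t => @proot_exprn R p t p0) pade.
have [gx [dg Lg]] := is_diff_pade_step p0 uB N1 DN dDN.
have idem X : L (L X) = L X by rewrite /L Lg pade_step_diff_idem.
split=> //; last by move=> E F; rewrite /L Lg.
exact: stable_at_idempotent.
Qed.
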